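(* Let $n,r\ge 1$, let $A=(A_{ji})$ be a real $r\times n$ matrix with linearly independent rows, let $\mathbf{w}\in\mathbb{R}^n$ with all $w_i>0$ and $\mathbf{t}\in\mathbb{R}^r$ with all $t_j>0$. Consider the problem of minimizing $\langle \mathbf{x},\mathbf{w}\rangle=\sum_{i=1}^n w_i x_i$ over all admissible vectors $\mathbf{x}\ge 0$, i.e. those satisfying $\sum_{i=1}^n A_{ji}\log x_i=\log t_j$ for $j=1,\dots,r$. A minimizer (an admissible vector at which the infimum of $\langle \mathbf{x},\mathbf{w}\rangle$ over admissible vectors is attained) exists if and only if the system of constraints is compact.
   Context: A variable $x_i$ is called nonessential if $A_{ji}=0$ for all $j$, and essential otherwise. In an admissible vector, essential variables must be strictly positive, while nonessential variables may take any value $\ge 0$ (including $0$; terms $A_{ji}\log x_i$ with $A_{ji}=0$ are read as $0$). The system of constraints is called compact if some linear combination of the rows of $A$ has strictly positive coefficients at all essential variables. *)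

(* Defs.v *)
From HB Require Import structures.
From mathcomp Require Import all_boot all_order all_algebra.
From mathcomp Require Import all_classical all_reals all_analysis.

Set Implicit Arguments.
Unset Strict Implicit.
Unset Printing Implicit Defensive.

Import Order.TTheory GRing.Theory Num.Theory.
Local Open Scope classical_set_scope.
Local Open Scope ring_scope.

Definition nonessential (R : realType) (r n : nat) (A : 'M[R]_(r, n))
    (i : 'I_n) : Prop :=
  forall j : 'I_r, A j i = 0.

Definition essential (R : realType) (r n : nat) (A : 'M[R]_(r, n))
    (i : 'I_n) : Prop :=
  ~ nonessential A i.

(* [ln] is total, so the convention that a term with zero coefficient is read
   as 0, even at [x 0 i = 0], holds because [0 * ln (x 0 i) = 0]. *)
Definition admissible (R : realType) (r n : nat) (A : 'M[R]_(r, n))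
    (t : 'rV[R]_r) (x : 'rV[R]_n) : Prop :=
  [/\ forall i : 'I_n, 0 <= x 0 i,
      forall i : 'I_n, essential A i -> 0 < x 0 i
    & forall j : 'I_r, \sum_(i < n) A j i * ln (x 0 i) = ln (t 0 j)].

Definition compact_system (R : realType) (r n : nat) (A : 'M[R]_(r, n)) :
    Prop :=
  exists c : 'rV[R]_r, forall i : 'I_n, essential A i -> 0 < (c *m A) 0 i.

Definition dotp (R : realType) (n : nat) (x w : 'rV[R]_n) : R :=
  \sum_(i < n) w 0 i * x 0 i.

(* [inf] has a default value on sets that are empty or unbounded below. For
   positive [w] it plays no role here: admissibility of [x] makes the set of
   values nonempty, and 0 is a lower bound of it. *)
Definition is_minimizer (R : realType) (r n : nat) (A : 'M[R]_(r, n))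
    (t : 'rV[R]_r) (w x : 'rV[R]_n) : Prop :=
  admissible A t x /\
  dotp x w = inf [set dotp y w | y in [set y | admissible A t y]].

(* Main.v *)
Require Import Defs.
From HB Require Import structures.
From mathcomp Require Import all_boot all_order all_algebra.
From mathcomp Require Import all_classical all_reals all_analysis.

Set Implicit Arguments.
Unset Strict Implicit.
Unset Printing Implicit Defensive.

Import Order.TTheory GRing.Theory Num.Theory.
Local Open Scope ring_scope.

(** In logarithmic coordinates [u_i = ln x_i] the constraints are affine and the
   objective is [sum_i w_i exp (u_i)]. If [x] is a minimizer and [A v = 0], then
   [x_i exp (s v_i)] is admissible for every [s], and the derivative at [s = 0]
   shows that [(w_i x_i)_i] is orthogonal to [ker A], hence lies in the row
   space of [A]; it is positive at the essential variables. Conversely, if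
   [d = c A] is positive at the essential variables, then on a sublevel set of
   the objective the [u_i] are bounded above, and since [sum_i d_i u_i] is
   constant there they are also bounded below, so the extreme value theorem
   applies. *)

Import numFieldNormedType.Exports.
Local Open Scope classical_set_scope.

Section Minimizers.
Context {R : realType} {r n : nat}.
Implicit Types (A : 'M[R]_(r, n)) (t : 'rV[R]_r) (u v w x y : 'rV[R]_n).

Lemma is_minimizerP A t w x : (forall i, 0 < w 0 i) ->
  is_minimizer A t w x <->
  admissible A t x /\ forall y, admissible A t y -> dotp x w <= dotp y w.
Proof.
move=> w_gt0.
have lb0 : lbound [set dotp y w | y in [set y | admissible A t y]] 0.
  by move=> _ [y [y_ge0 _ _] <-]; apply: sumr_ge0 => i _;
    rewrite mulr_ge0 // ltW.
split=> -[adm_x].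
  move=> x_inf; split=> // y adm_y; rewrite x_inf.
  by apply: ge_inf; [exists 0 | exists y].
move=> x_min; split=> //; apply/eqP; rewrite eq_le; apply/andP; split.
  apply: lb_le_inf; first by exists (dotp x w); exists x.
  by move=> _ [y adm_y <-]; exact: x_min.
by apply: ge_inf; [exists 0 | exists x].
Qed.

(** Fermat's rule: the right-hand side is minimal at [s = 0], and its derivative there is
    [\sum_i a i * v i]. *)
Lemma sum_expR_min_stationary (a v : 'I_n -> R) :
  (forall s, \sum_i a i <= \sum_i a i * expR (s * v i)) ->
  \sum_i a i * v i = 0.
Proof.
move=> a_min.
pose f : R -> R := \sum_i (fun s : R => a i * expR (s * v i)).
have fE s : f s = \sum_i a i * expR (s * v i) by rewrite /f fct_sumE.
have df (s : R) : is_derive s (1 : R) f (\sum_i a i * (v i * expR (s * v i))).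
  apply: is_derive_sum => i.
  apply: is_derive_eq.
  by rewrite scaler0 add0r /GRing.scale /= mulr1 [expR _ * _]mulrC.
have f_min0 : is_derive (0 : R) (1 : R) f 0.
  apply: (@derive1_at_min _ f (-1) 1 0).
  - by apply: (@le_trans _ _ 0).
  - by move=> s _; exact: ex_derive.
  - by rewrite in_itv /= ltrN10 ltr01.
  move=> s _; rewrite !fE; under eq_bigr do rewrite mul0r expR0 mulr1.
  exact: a_min.
have := @derive_val _ _ _ _ _ _ _ f_min0.
rewrite (@derive_val _ _ _ _ _ _ _ (df 0)) => df0.
by rewrite -[RHS]df0; apply: eq_bigr => i _; rewrite mul0r expR0 mulr1.
Qed.

Lemma admissible_scale_kernel A t x v s :
  (forall j, \sum_i A j i * v 0 i = 0) -> admissible A t x ->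
  admissible A t (\row_i (x 0 i * expR (s * v 0 i))).
Proof.
move=> Av0 [x_ge0 x_gt0 xE]; split=> [i|i ess_i|j].
- by rewrite mxE mulr_ge0 // expR_ge0.
- by rewrite mxE mulr_gt0 ?expR_gt0 // x_gt0.
transitivity (\sum_i (A j i * ln (x 0 i) + s * (A j i * v 0 i))); last first.
  by rewrite big_split /= -mulr_sumr Av0 mulr0 addr0.
apply: eq_bigr => i _; rewrite mxE.
(* The logarithm of the product splits only if [x 0 i > 0]; a nonzero [A j i] makes [i] essential
   and so ensures this. *)
have [->|Aji] := eqVneq (A j i) 0; first by rewrite !mul0r mulr0 addr0.
have ess_i : essential A i by move=> /(_ j)/eqP; exact/negP.
by rewrite lnM ?posrE ?expR_gt0 ?x_gt0 // expRK mulrDr mulrCA.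
Qed.

Lemma minimizer_compact A t w x : (forall i, 0 < w 0 i) ->
  is_minimizer A t w x -> compact_system A.
Proof.
move=> w_gt0 /(is_minimizerP _ _ _ w_gt0) [adm_x x_min].
pose g : 'rV[R]_n := \row_i (w 0 i * x 0 i).
(* Membership in the row space is tested on the columns of [cokermx A]; each of them is killed by
   [A] and serves as a direction [v]. *)
have /submxP [c gE] : (g <= A)%MS.
  rewrite submxE; apply/eqP/rowP => k; rewrite !mxE.
  under eq_bigr do rewrite mxE.
  apply: sum_expR_min_stationary => s.
  have Av0 j : \sum_i A j i * (\row_i cokermx A i k : 'rV_n) 0 i = 0.
    have /matrixP /(_ j k) := mulmx_coker A; rewrite !mxE => AK.
    by rewrite -[RHS]AK; apply: eq_bigr => i _; rewrite mxE.
  have /x_min := admissible_scale_kernel s Av0 adm_x.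
  rewrite /dotp; congr (_ <= _); apply: eq_bigr => i _.
  by rewrite !mxE mulrA.
exists c => i ess_i; rewrite -gE mxE mulr_gt0 //.
by case: adm_x => _ + _; apply.
Qed.

(** Nonessential coordinates get 0, their cheapest admissible value. *)
Definition exp_point A u : 'rV[R]_n :=
  \row_i (if `[< nonessential A i >] then 0 else expR (u 0 i)).

Definition log_solution A t u :=
  forall j, \sum_i A j i * u 0 i = ln (t 0 j).

Lemma exp_point_admissible A t u :
  log_solution A t u -> admissible A t (exp_point A u).
Proof.
move=> uE; split=> [i|i ess_i|j].
- by rewrite mxE; case: asboolP => // _; exact: expR_ge0.
- by rewrite mxE; case: asboolP => // _; exact: expR_gt0.
rewrite -uE; apply: eq_bigr => i _; rewrite mxE.
by case: asboolP => [->|_]; rewrite ?mul0r ?expRK.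
Qed.

Lemma admissible_log_solution A t y : admissible A t y ->
  log_solution A t (map_mx (@ln R) y).
Proof. by case=> _ _ yE j; rewrite -yE; apply: eq_bigr => i _; rewrite mxE. Qed.

(** The round trip through [ln] fixes essential coordinates and lowers the others to 0. Hence it
    suffices to minimize over points [exp_point A u]. *)
Lemma dotp_exp_point_log A t w y : (forall i, 0 < w 0 i) -> admissible A t y ->
  dotp (exp_point A (map_mx (@ln R) y)) w <= dotp y w.
Proof.
move=> w_gt0 [y_ge0 y_gt0 _]; apply: ler_sum => i _.
rewrite ler_wpM2l ?(ltW (w_gt0 i)) // !mxE.
by case: asboolP => [//|/y_gt0 yi]; rewrite lnK.
Qed.

(** Independent rows give [A] a right inverse, which solves the system for any right-hand side. *)
Lemma log_solution_exists A t : row_free A -> exists u, log_solution A t u.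
Proof.
move=> /row_freeP [B AB1].
exists (\row_i (B *m \col_j ln (t 0 j)) i 0) => j.
have : (A *m (B *m \col_j ln (t 0 j))) j 0 = ln (t 0 j).
  by rewrite mulmxA AB1 mul1mx mxE.
by rewrite mxE => <-; apply: eq_bigr => i _; rewrite mxE.
Qed.

(* Nonessential coordinates of [u] are unconstrained, hence the restriction to
   those [u] that vanish there. *)
Lemma sublevel_bounded A t w M : (forall i, 0 < w 0 i) -> compact_system A ->
  exists a b : 'I_n -> R, forall u, log_solution A t u ->
    (forall i, nonessential A i -> u 0 i = 0) ->
    dotp (exp_point A u) w <= M -> forall i, a i <= u 0 i <= b i.
Proof.
move=> w_gt0 [c d_gt0]; set d := c *m A in d_gt0.
have d0 i : nonessential A i -> d 0 i = 0.
  by move=> Ai0; rewrite mxE big1 // => j _; rewrite Ai0 mulr0.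
(* At an essential [i] the bound comes from [w_i u_i <= w_i exp (u_i) <= M]. *)
pose b i := if `[< nonessential A i >] then 0 else M / w 0 i.
(* This is the value of [\sum_i d_i (b_i - u_i)] for every solution [u]. Its terms are nonnegative,
   so each is at most [C], which gives the lower bound [a]. *)
pose C := \sum_i d 0 i * b i - \sum_j c 0 j * ln (t 0 j).
pose a i := if `[< nonessential A i >] then 0 else b i - C / d 0 i.
exists a, b => u uE u0 uM.
have w_ge0 i : 0 <= w 0 i * exp_point A u 0 i.
  rewrite mulr_ge0 ?(ltW (w_gt0 i)) // mxE.
  by case: asboolP => // _; exact: expR_ge0.
have u_le_b i : u 0 i <= b i.
  rewrite /b; case: asboolP => [/u0 ->//|ess_i].
  rewrite ler_pdivlMr // (le_trans _ uM) //.
  apply: (@le_trans _ _ (w 0 i * exp_point A u 0 i)).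
    rewrite mulrC ler_pM2l // mxE; case: asboolP => // _.
    by apply: le_trans (expR_ge1Dx _); rewrite lerDr.
  by rewrite /dotp (bigD1 i) //= lerDl sumr_ge0.
have CE : \sum_i d 0 i * (b i - u 0 i) = C.
  rewrite /C; under eq_bigr do rewrite mulrBr.
  rewrite sumrB; congr (_ - _).
  under eq_bigr do rewrite mxE mulr_suml.
  rewrite exchange_big /=; apply: eq_bigr => j _; rewrite -uE mulr_sumr.
  by apply: eq_bigr => i _; rewrite mulrA.
move=> i; rewrite u_le_b andbT /a.
case: asboolP => [/u0 ->//|ess_i].
have di := d_gt0 i ess_i.
rewrite lerBlDr -lerBlDl ler_pdivlMr // mulrC -CE (bigD1 i) //= lerDl.
apply: sumr_ge0 => k _.
case: (pselect (nonessential A k)) => [/d0 ->|/d_gt0 dk].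
  by rewrite mul0r.
by rewrite mulr_ge0 ?(ltW dk) // subr_ge0.
Qed.

(** A normalization that preserves both the linear constraints and [exp_point], while making the
    sublevel sets bounded. *)
Definition essential_part A u : 'rV[R]_n :=
  \row_i (if `[< nonessential A i >] then 0 else u 0 i).

Lemma log_solution_essential_part A t u :
  log_solution A t u -> log_solution A t (essential_part A u).
Proof.
move=> uE j; rewrite -uE; apply: eq_bigr => i _; rewrite mxE.
by case: asboolP => // ->; rewrite !mul0r.
Qed.

Lemma exp_point_essential_part A u :
  exp_point A (essential_part A u) = exp_point A u.
Proof. by apply/rowP => i; rewrite !mxE; case: asboolP. Qed.

Lemma continuous_sum_rV (f : 'I_n -> R -> R) :
  (forall i, continuous (f i)) ->
  continuous (fun u : 'rV[R]_n => \sum_i f i (u 0 i)).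
Proof.
move=> f_cont; apply: continuous_big => [|i _ u]; first exact: add_continuous.
apply: (@continuous_comp _ _ _ (fun u : 'rV[R]_n => u 0 i) (f i)).
  exact: coord_continuous.
exact: f_cont.
Qed.

Lemma continuous_dotp_exp_point A w :
  continuous (fun u : 'rV[R]_n => dotp (exp_point A u) w).
Proof.
pose f i (z : R) := w 0 i * if `[< nonessential A i >] then 0 else expR z.
have -> : (fun u : 'rV[R]_n => dotp (exp_point A u) w) =
    (fun u => \sum_i f i (u 0 i)).
  by apply/funext => u; apply: eq_bigr => i _; rewrite mxE.
apply: continuous_sum_rV => i z.
apply: cvgM; first exact: cvg_cst.
by case: asboolP => _; [exact: cvg_cst | exact: continuous_expR].
Qed.

Lemma closed_log_solution A t : closed [set u | log_solution A t u].
Proof.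
have -> : [set u | log_solution A t u] = \bigcap_j
    ((fun u : 'rV[R]_n => \sum_i A j i * u 0 i) @^-1` [set ln (t 0 j)]).
  by apply/seteqP; split=> u uE j => [_|]; exact: uE.
apply: closed_bigI => j _; apply: preimage_closed; last exact: closed_eq.
move=> u _; apply: (@continuous_sum_rV (fun i z => A j i * z)) => i z.
by apply: cvgM; [exact: cvg_cst | exact: cvg_id].
Qed.

Lemma compact_minimizer A t w : row_free A -> (forall i, 0 < w 0 i) ->
  compact_system A -> exists x, is_minimizer A t w x.
Proof.
move=> freeA w_gt0 cmpA.
have [u0 u0E] := log_solution_exists t freeA.
pose F u := dotp (exp_point A u) w.
have [a [b ab]] := sublevel_bounded t (F u0) w_gt0 cmpA.
have abK u : log_solution A t u -> F u <= F u0 ->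
    forall i, a i <= essential_part A u 0 i <= b i.
  move=> uE uF; apply: ab; first exact: log_solution_essential_part.
    by move=> i Ai0; rewrite mxE asboolT.
  by rewrite exp_point_essential_part.
(* A compact set of solutions that contains the normalized form of every solution [u] with
   [F u <= F u0]. *)
pose K := [set u : 'rV[R]_n | forall i, `[a i, b i] (u 0 i)] `&`
  [set u | log_solution A t u].
have K_mem u : log_solution A t u -> F u <= F u0 ->
    K (essential_part A u).
  move=> uE uF; split; last exact: log_solution_essential_part.
  by move=> i /=; rewrite in_itv /=; exact: abK.
have K0 : K !=set0.
  by exists (essential_part A u0); exact: K_mem.
have K_compact : compact K.
  apply: compact_closedI; last exact: closed_log_solution.
  by apply: (@rV_compact _ _ (fun i => `[a i, b i])) => i;
    exact: segment_compact.
have [u /set_mem[_ uE] u_min] := EVT_min_rV K0 K_compact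
  (continuous_subspaceT (@continuous_dotp_exp_point A w)).
exists (exp_point A u); apply/is_minimizerP => //; split.
  exact: exp_point_admissible.
move=> y adm_y; apply: le_trans (dotp_exp_point_log w_gt0 adm_y).
have yE := admissible_log_solution adm_y.
(* Inside the sublevel set, [y] is compared with the minimum through its normalized logarithm in
   [K]; outside, [u0] already does better, and its normalized form lies in [K]. *)
have [yF|/ltW Fy] := leP (F (map_mx (@ln R) y)) (F u0).
  rewrite -(exp_point_essential_part A (map_mx _ y)).
  by apply/u_min/mem_set/K_mem.
apply: le_trans Fy; rewrite /F -(exp_point_essential_part A u0).
by apply/u_min/mem_set/K_mem.
Qed.

End Minimizers.

Theorem mainTheorem1 (R : realType) (n r : nat) (hn : (1 <= n)%N)
    (hr : (1 <= r)%N) (A : 'M[R]_(r, n)) (hA : row_free A)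
    (w : 'rV[R]_n) (hw : forall i : 'I_n, 0 < w 0 i)
    (t : 'rV[R]_r) (ht : forall j : 'I_r, 0 < t 0 j) :
  (exists x : 'rV[R]_n, is_minimizer A t w x) <-> compact_system A.
Proof.
split=> [[x]|]; first exact: minimizer_compact.
exact: compact_minimizer.
Qed.
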